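(* Let $G=(V,V_0,V_1,E)$ be an arena, let $(\mathcal{F}_0,\mathcal{F}_1)$ be a partition of $2^V$, and let $i\in\{0,1\}$. If $W_i$ is the winning region of Player $i$ in the Muller game $(G,\mathcal{F}_0,\mathcal{F}_1)$, and $W_i'$ is the winning region of Player $i$ in the finite-time Muller game $(G,\mathcal{F}_0,\mathcal{F}_1,3)$ with threshold $3$, then $W_i=W_i'$.
   Context: An arena $G=(V,V_0,V_1,E)$ is a finite directed graph $(V,E)$ in which every vertex has at least one outgoing edge, with a partition $(V_0,V_1)$ of $V$ into the positions of Player $0$ and Player $1$. A play starting in $v$ is an infinite path $\rho_0\rho_1\rho_2\cdots$ with $\rho_0=v$. A strategy for Player $i$ is a function $\sigma\colon V^*V_i\to V$ with $(s,\sigma(ws))\in E$ for all $ws\in V^*V_i$; a play is consistent with $\sigma$ if $\rho_{m+1}=\sigma(\rho_0\cdots\rho_m)$ whenever $\rho_m\in V_i$. Muller game $(G,\mathcal{F}_0,\mathcal{F}_1)$, where $(\mathcal{F}_0,\mathcal{F}_1)$ is a partition of $2^V$: Player $i$ wins a play $\rho$ iff the set of vertices occurring infinitely often in $\rho$ belongs to $\mathcal{F}_i$. The winning region of Player $i$ is the set of vertices $v$ for which Player $i$ has a strategy such that every play starting in $v$ consistent with it is won by Player $i$. For a finite word $x$ over $V$, $\mathrm{Occ}(x)$ is the set of vertices occurring in $x$. For $F\subseteq V$ and $w\in V^+$, the score $\mathrm{Sc}_F(w)$ is the maximal $k\in\mathbb{N}$ such that there are non-empty words $x_1,\dots,x_k\in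 V^+$ with $\mathrm{Occ}(x_j)=F$ for all $j$ and $x_1\cdots x_k$ a suffix of $w$. For $\mathcal{F}\subseteq 2^V$ and a finite or infinite word $\rho$, $\mathrm{MaxSc}_{\mathcal{F}}(\rho)=\max_{F\in\mathcal{F}}\max_{w\sqsubseteq\rho}\mathrm{Sc}_F(w)$, where $w$ ranges over finite non-empty prefixes of $\rho$. Finite-time Muller game $(G,\mathcal{F}_0,\mathcal{F}_1,k)$ with threshold $k\ge 2$: a play is a finite path $w_0\cdots w_n$ with $\mathrm{MaxSc}_{2^V}(w_0\cdots w_n)=k$ but $\mathrm{MaxSc}_{2^V}(w_0\cdots w_{n-1})<k$ (every infinite path has exactly one such prefix). It is known that there is then a unique $F\subseteq V$ with $\mathrm{Sc}_F(w_0\cdots w_n)=k$; Player $0$ wins the play if $F\in\mathcal{F}_0$, and Player $1$ wins otherwise. Strategies, consistency, and winning regions are defined as for infinite plays. *)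

(* Defs.v *)
From HB Require Import structures.
From mathcomp Require Import all_boot.
From mathcomp Require Import boolp.

Set Implicit Arguments.
Unset Strict Implicit.
Unset Printing Implicit Defensive.

Inductive player := Player0 | Player1.

(* A (possibly empty-sided) partition of T into an ordered pair; the [partition]
   of finset is unsuitable, since it requires every block to be nonempty. *)
Definition bipartition (T : finType) (A : player -> {set T}) : Prop :=
  A Player0 :|: A Player1 = setT /\ A Player0 :&: A Player1 = set0.

Record arena (V : finType) := Arena {
  pos : player -> {set V};
  edge : rel V;
  pos_bipartition : bipartition pos;
  edge_total : forall u, exists v, edge u v
}.

(* [sigma w s] is the move prescribed after the word [w s].  Only its values at
   words ending in a position of the player in question are ever used, so this
   is the same as a function on the words of V^* V_i. *)
Definition strategy (V : finType) := seq V -> V -> V.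

Definition is_strategy (V : finType) (G : arena V) (i : player)
    (sigma : strategy V) : Prop :=
  forall (w : seq V) (s : V), s \in pos G i -> edge G s (sigma w s).

Section MullerGame.
Variables (V : finType) (G : arena V) (F : player -> {set {set V}}).

Definition is_play (v : V) (rho : nat -> V) : Prop :=
  rho 0 = v /\ forall m, edge G (rho m) (rho m.+1).

Definition consistent (i : player) (sigma : strategy V) (rho : nat -> V) : Prop :=
  forall m, rho m \in pos G i -> rho m.+1 = sigma (mkseq rho m) (rho m).

Definition inf_occ (rho : nat -> V) : {set V} :=
  [set v | `[< forall n, exists2 m, n <= m & rho m = v >]].

Definition muller_wins (i : player) (rho : nat -> V) : Prop :=
  inf_occ rho \in F i.

Definition muller_region (i : player) : {set V} :=
  [set v | `[< exists sigma : strategy V, is_strategy G i sigma /\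
      forall rho : nat -> V,
        is_play v rho -> consistent i sigma rho -> muller_wins i rho >]].

End MullerGame.

Definition Occ (V : finType) (x : seq V) : {set V} := [set v in x].

Definition has_score_blocks (V : finType) (F : {set V}) (w : seq V) (k : nat)
    : Prop :=
  exists xs : seq (seq V),
    [/\ size xs = k,
        forall x, x \in xs -> x != [::] /\ Occ x = F
      & suffix (flatten xs) w].

(* The blocks are nonempty, so at most [size w] of them fit in [w] and the
   bound on the range of the maximum excludes nothing. *)
Definition score (V : finType) (F : {set V}) (w : seq V) : nat :=
  \max_(k < (size w).+1 | `[< has_score_blocks F w k >]) k.

Definition max_score (V : finType) (Fs : {set {set V}}) (w : seq V) : nat :=
  \max_(A in Fs) \max_(n < size w) score A (take n.+1 w).

Section FiniteTimeMullerGame.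
Variables (V : finType) (G : arena V) (F : player -> {set {set V}}) (k : nat).

(* The finite play w_0 ... w_n is [v :: p], with w_0 = v; [belast v p] is
   w_0 ... w_(n-1). *)
Definition is_finite_play (v : V) (p : seq V) : Prop :=
  [/\ path (edge G) v p,
      max_score setT (v :: p) = k
    & max_score setT (belast v p) < k].

Definition finite_consistent (i : player) (sigma : strategy V)
    (v : V) (p : seq V) : Prop :=
  let w := v :: p in
  forall m, m.+1 < size w -> nth v w m \in pos G i ->
    nth v w m.+1 = sigma (take m w) (nth v w m).

(* For k >= 2 exactly one set has score k at the end of a finite play. *)
Definition finite_wins (i : player) (w : seq V) : Prop :=
  let wins0 := exists2 A : {set V}, score A w = k & A \in F Player0 in
  if i is Player0 then wins0 else ~ wins0.

Definition finite_time_region (i : player) : {set V} :=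
  [set v | `[< exists sigma : strategy V, is_strategy G i sigma /\
      forall p : seq V, is_finite_play v p -> finite_consistent i sigma v p ->
        finite_wins i (v :: p) >]].

End FiniteTimeMullerGame.

(* Main.v *)
Require Import Defs.
From HB Require Import structures.
From mathcomp Require Import all_boot.
From mathcomp Require Import boolp zify.

Set Implicit Arguments.
Unset Strict Implicit.
Unset Printing Implicit Defensive.

(** Each vertex is won by a player with a strategy that keeps every score of the
    opponent's sets below 3.  Such a strategy wins both games, and the winning
    regions of the two players are disjoint in either game, so both games have
    the same regions.  The bound follows from Zielonka's recursion, once it is
    strengthened to plays with a history in which the scores of the opponent's
    sets are 0 or have just become 1.  The player for whom the whole arena is
    winning plays in phases: each phase confines the play to a set [D] of the
    opponent that covers as much of the recent history as possible, and uses
    the strategy of the subgame outside the attractor of the complement of [D],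
    then the attractor to the complement.  A vertex that ends a phase does not
    belong to any opponent's set formed by the preceding vertices, so the history
    is again of the required form. *)

(** * Players, partitions and words *)

Definition opponent (p : player) : player :=
  if p is Player0 then Player1 else Player0.

Lemma player_cases (p q : player) : q = p \/ q = opponent p.
Proof. by case: p; case: q; auto. Qed.

Lemma bipartition_or (T : finType) (A : player -> {set T}) (p : player)
    (x : T) :
  bipartition A -> x \in A p \/ x \in A (opponent p).
Proof.
move=> [AU _]; have := in_setT x; rewrite -AU in_setU => /orP.
by case: p => -[]; [left|right|right|left].
Qed.

Lemma bipartition_disj (T : finType) (A : player -> {set T}) (p : player)
    (x : T) :
  bipartition A -> x \in A p -> x \in A (opponent p) -> False.
Proof.
move=> [_ AI]; have := in_set0 x; rewrite -AI in_setI.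
by case: p => /= H a b; move: H; rewrite a b.
Qed.

Lemma bipartition_opponent (T : finType) (A : player -> {set T}) (p : player)
    (x : T) : bipartition A -> (x \in A (opponent p)) = (x \notin A p).
Proof.
move=> bA; apply/idP/negP => [xo xp|xp]; first exact: bipartition_disj xp xo.
by case: (bipartition_or p x bA).
Qed.

(** Levi's lemma, used throughout to compare the blocks of a triple with the parts of a history. *)
Lemma cat_eq_cat (T : Type) (a b c d : seq T) :
  a ++ b = c ++ d -> size a <= size c ->
  exists e, c = a ++ e /\ b = e ++ d.
Proof.
move=> eq le; exists (drop (size a) c).
have -> : b = drop (size a) (c ++ d) by rewrite -eq drop_size_cat.
have ac : take (size a) c = a by rewrite -(takel_cat d le) -eq take_size_cat.
rewrite -{1}(cat_take_drop (size a) c) ac; split=> //.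
rewrite drop_cat; case: ltngtP le => // -> _.
by rewrite drop_size subnn drop0.
Qed.

(** * Plays that keep the opponent's scores below 3 *)

Section SafePlay.
Variables (V : finType) (G : arena V) (F : player -> {set {set V}}).
Implicit Types (p : player) (X A U S T D : {set V}) (K : {set {set V}}).
Implicit Types (r h s t : seq V) (E : seq V -> Prop).

Definition losing_sets p X : {set {set V}} :=
  [set A in F (opponent p) | A \subset X].

Lemma losing_setsS p X (Y : {set V}) :
  X \subset Y -> losing_sets p X \subset losing_sets p Y.
Proof.
move=> XY; apply/subsetP => A; rewrite !inE => /andP[-> /=].
by move/subset_trans; apply.
Qed.

(* From here on, words are reversed: the most recent vertex comes first. *)
Definition triple K r : Prop :=
  exists x3 x2 x1 t,
    [/\ r = x3 ++ x2 ++ x1 ++ t, Occ x3 \in K, x3 != [::], x2 =i x3 & x1 =i x3].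

(* For every [A] in [K], the score of [A] in [v :: h] is 0, or it has just been
   raised to 1 by [v]. *)
Definition burden K h v : Prop :=
  forall u t, h = u ++ t -> Occ u \in K -> v \notin u.

Lemma burden_nil K v : burden K [::] v.
Proof. by case. Qed.

Lemma burdenS K K' h v : K \subset K' -> burden K' h v -> burden K h v.
Proof. by move=> /subsetP KK' b u t hut /KK'; apply: b hut. Qed.

(** The two newer blocks cannot reach [v]: otherwise their remainder [h1] below [v], together with
    [x1], would be a most recent part of [h] that forms a set of [K] and contains [v]. *)
Lemma burden_cat K h v s x3 x2 x1 t :
  burden K h v -> s ++ v :: h = x3 ++ x2 ++ x1 ++ t -> Occ x3 \in K ->
  x2 =i x3 -> x1 =i x3 ->
  exists s', s = x3 ++ x2 ++ s' /\ x1 ++ t = s' ++ v :: h.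
Proof.
move=> b e xK e2 e1; rewrite catA in e.
have [le|lt] := leqP (size (x3 ++ x2)) (size s).
  have [s' [sE tE]] := cat_eq_cat (esym e) le.
  by exists s'; rewrite catA.
have [[|v' h1] [x32 hE]] := cat_eq_cat e (ltnW lt).
  by rewrite x32 cats0 ltnn in lt.
case: hE => ? hE; subst v'; rewrite catA in hE.
have sub y : y \in v :: h1 -> y \in x3.
  move=> yh; have : y \in x3 ++ x2 by rewrite x32 mem_cat yh orbT.
  by rewrite mem_cat e2 orbb.
have oE : Occ (h1 ++ x1) = Occ x3.
  apply/setP => y; rewrite !inE mem_cat e1.
  by apply/orP/idP => [[yh|//]|->]; [apply: sub; rewrite inE yh orbT|right].
have := b _ _ hE; rewrite oE => /(_ xK); rewrite mem_cat negb_or e1.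
by rewrite sub ?mem_head ?andbF.
Qed.

Lemma burden_no_triple K h v : burden K h v -> ~ triple K (v :: h).
Proof.
move=> b [x3 [x2 [x1 [t [e xK x0 e2 e1]]]]].
have [s' [e' _]] := burden_cat (s := [::]) b e xK e2 e1.
by case: x3 x0 e' {e xK e2 e1}.
Qed.

(** The controllable predecessor of [P] for player [p] in the subgraph on [X]. *)
Definition force p X (P : V -> Prop) v : Prop :=
  if v \in pos G p then exists u, [/\ edge G v u, u \in X & P u]
  else forall u, edge G v u -> u \in X -> P u.

Lemma force_mono p X (P Q : V -> Prop) v :
  (forall u, u \in X -> P u -> Q u) -> force p X P v -> force p X Q v.
Proof.
rewrite /force => PQ; case: ifP => _; first by
  case=> u [? ? ?]; exists u; split; auto.
by move=> H u vu uX; apply: PQ => //; apply: H.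
Qed.

(* The invariant [I] replaces a strategy with memory: [p] keeps the play in [I],
   hence in [A], until a word of [E] is reached. *)
Definition safe_until p X A K E r : Prop :=
  exists I : seq V -> Prop, I r /\ forall r', I r' ->
    exists v h, [/\ r' = v :: h, v \in A, ~ triple K r'
      & force p X (fun u => I (u :: r') \/ E (u :: r')) v].

Definition safe p X A K := safe_until p X A K (fun=> False).

Lemma safe_untilP p X A K E r : safe_until p X A K E r ->
  exists v h, [/\ r = v :: h, v \in A, ~ triple K r
    & force p X (fun u => safe_until p X A K E (u :: r) \/ E (u :: r)) v].
Proof.
move=> [I [Ir HI]]; have [v [h [rE vA nt fo]]] := HI _ Ir.
exists v, h; split=> //; apply: force_mono fo => u _ [Iu|]; last by right.
by left; exists I.
Qed.

Lemma safeP p X A K r : safe p X A K r ->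
  exists v h, [/\ r = v :: h, v \in A, ~ triple K r
    & force p X (fun u => safe p X A K (u :: r)) v].
Proof.
move=> /safe_untilP [v [h [rE vA nt fo]]]; exists v, h; split=> //.
by apply: force_mono fo => u _ [].
Qed.

(** This chains phases: [safe_until], the union of all its invariants, is itself an invariant, and a
    word of [E] re-enters it. *)
Lemma safe_coind p X A K E :
  (forall r, E r -> safe_until p X A K E r) ->
  forall r, E r -> safe p X A K r.
Proof.
move=> H r /H sr; exists (safe_until p X A K E); split=> // r'.
move=> /safe_untilP [v [h [rE vA nt fo]]]; exists v, h; split=> //.
by apply: force_mono fo => u _ [su|/H su]; left.
Qed.

Lemma safeS p X A (B : {set V}) K r :
  A \subset B -> safe p X A K r -> safe p X B K r.
Proof.
move=> /subsetP AB [I [Ir HI]]; exists I; split=> // r' /HI.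
by move=> [v [h [rE vA nt fo]]]; exists v, h; split=> //; apply: AB.
Qed.

(** The history [h] is arbitrary and may leave [X], but only the opponent's sets inside [X] are
    counted; this lets subgames inherit a history. *)
Definition solved p X A : Prop :=
  A \subset X /\ forall v h, v \in A -> burden (losing_sets p X) h v ->
    safe p X A (losing_sets p X) (v :: h).

Lemma solved0 p X : solved p X set0.
Proof. by split=> [|v h]; rewrite ?sub0set ?inE. Qed.

(* On entering [U] the history is forgotten: a triple stretching over both parts
   has a vertex of [S] and a vertex of [U] in each block, so its first block
   lies in [h] and contains [v]. *)
Lemma solved_union p X S U :
  solved p X U -> S \subset X -> [disjoint S & U] ->
  (forall v h, v \in S -> burden (losing_sets p X) h v ->
    safe_until p X S (losing_sets p X)
      (fun r => exists u h', r = u :: h' /\ u \in U) (v :: h)) ->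
  solved p X (S :|: U).
Proof.
move=> [UX sU] SX dSU sS; split; first by rewrite subUset SX.
set K := losing_sets p X in sU sS *.
move=> v h; rewrite inE => /orP[vS|vU] b; last first.
  by apply: safeS (sU _ _ vU b); apply: subsetUr.
have notU y : y \in S -> y \notin U by move=> yS; rewrite (disjointFr dSU yS).
have [I [Iv HI]] := sS _ _ vS b.
(* Either the play is still in [S], or it has entered [U] and its part [y] there is safe on its
   own. *)
exists (fun r => (exists s, [/\ r = s ++ v :: h, all [in S] s & I r]) \/
  (exists y s, [/\ r = y ++ s ++ v :: h, all [in U] y, all [in S] s
     & safe p X U K y])); split; first by left; exists [::].
move=> r [[s [rE sSs Ir]]|[y [s [rE yU sSs]]]].
  have [c [h' [rE' cS nt fo]]] := HI _ Ir.
  exists c, h'; split=> //; first by rewrite inE cS.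
  apply: force_mono fo => u uX [Iu|[_ [_ [[<- _] uU]]]]; left; [left|right].
    have [_ [_ [[<- _] uS _ _]]] := HI _ Iu.
    by exists (u :: s); split; rewrite //= ?uS // -rE.
  exists [:: u], s; rewrite /= uU rE; split=> //.
  exact: sU uU (@burden_nil _ _).
move=> sy; have [c [y' [yE cU nty fo]]] := safeP sy.
exists c, (y' ++ s ++ v :: h); split; first by rewrite rE yE.
- by rewrite inE cU orbT.
- move=> [x3 [x2 [x1 [t [e xK x0 e2 e1]]]]]; rewrite rE catA in e.
  have [s' [e' eh]] := burden_cat b e xK e2 e1.
  have cx3 : c \in x3.
    move: e'; rewrite yE; case: (x3) x0 => [//|c' x3' _ [-> _]].
    exact: mem_head.
  have cx2 : c \in x2 by rewrite e2.
  (* If [x3] covered [y], then [x2] would lie in [s], hence in [S], although it contains [c] from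
     [U]. *)
  have [le|lt] := leqP (size y) (size x3).
    have [y2 [_ eS]] := cat_eq_cat e' le.
    have : c \in s by rewrite eS !mem_cat cx2 !orbT.
    by move/(allP sSs)/notU; rewrite cU.
  (* So [x3] consists of vertices of [U]; then neither [x2] nor [x1] can reach a vertex of [S], and
     the whole triple lies in [y]. *)
  have [e3 [yE3 e3E]] := cat_eq_cat (esym e') (ltnW lt).
  have x3U z : z \in x3 -> z \notin S.
    move=> zx; rewrite (contraL (@notU z)) //; apply: (allP yU).
    by rewrite yE3 mem_cat zx.
  have [le2|lt2] := leqP (size x2) (size e3); last first.
    have [[|z e4] [x2E sE]] := cat_eq_cat (esym e3E) (ltnW lt2).
      by rewrite x2E cats0 ltnn in lt2.
    have /x3U/negP[] : z \in x3 by rewrite -e2 x2E mem_cat mem_head orbT.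
    by apply: (allP sSs); rewrite sE mem_head.
  have [e4 [e3E' s'E]] := cat_eq_cat e3E le2.
  rewrite s'E -catA in eh.
  have [le1|lt1] := leqP (size x1) (size e4).
    have [e5 [e4E _]] := cat_eq_cat eh le1.
    by apply: nty; exists x3, x2, x1, e5; rewrite yE3 e3E' e4E.
  have [[|z e5] [x1E sE]] := cat_eq_cat (esym eh) (ltnW lt1).
    by rewrite x1E cats0 ltnn in lt1.
  have /x3U/negP[] : z \in x3 by rewrite -e1 x1E mem_cat mem_head orbT.
  by case: (s) sE sSs => [[<- _]|z' ? [<- _] /andP[]].
- apply: force_mono fo => u uX su; left; right.
  exists (u :: y), s; rewrite rE; split=> //=; rewrite yU andbT.
  by have [? [? [[->]]]] := safeP su.
Qed.

(* One step of the attractor construction. *)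
Lemma solved_force p X U v :
  solved p X U -> v \in X -> v \notin U -> force p X [in U] v ->
  solved p X (v |: U).
Proof.
move=> sU vX vU fo; apply: solved_union => //; rewrite ?sub1set ?disjoints1 //.
move=> v' h /set1P-> b; exists (eq (v :: h)); split=> // _ <-.
exists v, h; split; rewrite ?set11 //; first exact: burden_no_triple b.
by apply: force_mono fo => u _ uU; right; exists u, (v :: h).
Qed.

(** The opponent can leave [T] only into [U]. By [burden_cat] the newest block of a triple lies in
    [s], so its set is contained in [T] and is already excluded by the subgame. *)
Lemma solved_subgame p X U T S :
  solved p X U -> T \subset X -> [disjoint S & U] ->
  (forall v u, v \in T -> v \notin pos G p -> edge G v u -> u \in X ->
    u \in T :|: U) ->
  solved p T S -> solved p X (S :|: U).
Proof.
move=> sU TX dSU trap [ST sS].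
apply: solved_union => //; first exact: subset_trans TX.
move=> v h vS b; have [I [Iv HI]] := sS _ _ vS (burdenS (losing_setsS p TX) b).
exists (fun r => exists s, [/\ r = s ++ v :: h, all [in S] s & I r]).
split; first by exists [::].
move=> r [s [rE sSs Ir]]; have [c [h' [rE' cS nt fo]]] := HI _ Ir.
exists c, h'; split=> //.
- move=> [x3 [x2 [x1 [t [e xK x0 e2 e1]]]]]; apply: nt.
  rewrite rE in e; have [s' [sE _]] := burden_cat b e xK e2 e1.
  move: xK; rewrite !inE => /andP[xL _].
  exists x3, x2, x1, t; rewrite rE inE xL; split=> //=.
  apply: subset_trans ST; apply/subsetP => z; rewrite inE => zx.
  by apply: (allP sSs); rewrite sE mem_cat zx.
- have IS u : I (u :: r) -> exists s0,
      [/\ u :: r = s0 ++ v :: h, all [in S] s0 & I (u :: r)].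
    move=> Iu; exists (u :: s); rewrite rE; split=> //=; rewrite ?sSs -?rE //.
    by have [? [? [[-> _] ->]]] := HI _ Iu.
  move: fo; rewrite /force; case: ifPn => cp.
    move=> [u [cu uT [Iu|//]]]; exists u; split=> //; first exact: (subsetP TX).
    by left; apply: IS.
  move=> fo u cu uX.
  have := trap c u (subsetP ST _ cS) cp cu uX; rewrite inE => /orP[uT|uU].
    by have [Iu|//] := fo u cu uT; left; apply: IS.
  by right; exists u, r.
Qed.

(** * Attractors and Zielonka's recursion *)

Lemma attractor p X (Y : {set V}) : Y \subset X ->
  exists (A : {set V}) (rk : V -> nat),
  [/\ Y \subset A, A \subset X,
    forall v, v \in A -> v \notin Y ->
      force p X (fun u => u \in A /\ rk u < rk v) v
  & forall v, v \in X -> force p X [in A] v -> v \in A].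
Proof.
move=> YX.
(* The attractor is a maximal set that admits a rank, not the result of an iteration; a vertex
   forced into it could be added with a rank above all others. *)
pose P A := [/\ Y \subset A, A \subset X & exists rk : V -> nat,
  forall v, v \in A -> v \notin Y ->
      force p X (fun u => u \in A /\ rk u < rk v) v].
have PY : P Y by split=> //; exists (fun=> 0) => v ->.
have [|A /maxsetP[/asboolP[YA AX [rk rkP]] maxA] _] :=
  @maxset_exists V (fun A => `[< P A >]) Y; first exact/asboolP.
exists A, rk; split=> // v vX fo; apply: contraT => vA.
suff /asboolP PvA : P (v |: A).
  by rewrite -(maxA _ PvA) ?subsetUr ?setU11 // in vA.
split; first by apply: subset_trans YA (subsetUr _ _).
  by rewrite subUset sub1set vX.
pose m := \max_(u : V) rk u.
exists (fun u => if u == v then m.+1 else rk u) => w.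
have neqv u : u \in A -> (u == v) = false by apply: contraTF => /eqP->.
rewrite !inE; case: eqP => [-> _ vY|_ /= wA wY].
  apply: force_mono fo => u _ uA; rewrite !inE uA orbT neqv // ltnS.
  by split=> //; apply: leq_bigmax.
apply: force_mono (rkP w wA wY) => u _ [uA ru].
by rewrite !inE uA orbT neqv.
Qed.

Definition subarena X := forall v, v \in X -> exists2 u, u \in X & edge G v u.

Lemma force_subarena p X (P : V -> Prop) v : subarena X -> v \in X ->
  (forall u, u \in X -> P u) -> force p X P v.
Proof.
move=> sX vX HP; rewrite /force; case: ifP => _ ; last by move=> u _ /HP.
by have [u uX vu] := sX v vX; exists u; split; auto.
Qed.

(** [D] maximizes the number of vertices of [r] before the first one outside it. *)
Lemma longest_cover K r D0 : D0 \in K ->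
  exists2 D, D \in K & (forall B q t, B \in K -> r = q ++ t ->
    all [in B] q -> all [in D] q).
Proof.
move=> D0K; pose len (D : {set V}) := find [predC D] r.
have [D DK Dmax] := @arg_maxnP _ D0 [in K] len D0K.
exists D => // B q t BK rE qB; have le : size q <= len D.
  apply: leq_trans (Dmax B BK); rewrite /len rE find_cat has_predC qB.
  exact: leq_addr.
case: q => // v q in rE qB le *; apply/(all_nthP v) => i iq.
have /(before_find v) : i < find [predC D] r by apply: leq_trans iq le.
by rewrite /= rE nth_cat iq => /negbFE.
Qed.

(* [E] holds of the words at which a phase may start, [D] is the set to which the
   phase confines the play, and [J] describes a phase: [s] is its part in the
   subgame [T], and [a] its part in the attractor [A], along which the rank
   decreases, so that no vertex is repeated there. *)
Lemma solved_phases p X : subarena X ->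
  (forall D A, D \in losing_sets p X -> X :\: D \subset A -> A \subset X ->
     (forall v, v \in X -> force p X [in A] v -> v \in A) ->
     solved p (X :\: A) (X :\: A)) ->
  solved p X X.
Proof.
move=> subX sol; set K := losing_sets p X in sol *; split=> // v0 h0 vX0 b0.
pose E r := exists v h, [/\ r = v :: h, v \in X & burden K h v].
apply: (@safe_coind p X X K E); last by exists v0, h0.
move=> _ {v0 h0 vX0 b0} [v [h [-> vX b]]].
have [/existsP[D0 /andP[D0K vD0]]|/existsPn noD] :=
  boolP [exists D, (D \in K) && (v \in D)]; last first.
  (* No opponent's set contains [v], so none is formed by recent vertices that include [v], and
     every successor may start a new phase. *)
  exists (eq (v :: h)); split=> // _ <-; exists v, h; split=> //.
    exact: burden_no_triple b.
  apply: force_subarena => // u uX; right; exists u, (v :: h); split=> //.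
  move=> [|v' q] t // [<- _] vqK; have := noD (Occ (v :: q)).
  by rewrite vqK inE mem_head.
have [D DK Dmax] := longest_cover (v :: h) D0K.
have vD : v \in D.
  by have := Dmax D0 [:: v] h D0K erefl; rewrite /= !andbT; apply.
have [|A [rk [YA AX rkP Aclosed]]] := @attractor p X (X :\: D).
  exact: subsetDl.
have [_ sT] := sol D A DK YA AX Aclosed; set T := X :\: A in sT.
have TX : T \subset X by apply: subsetDl.
have TD u : u \in T -> u \in D.
  rewrite inE => /andP[uA uX]; apply: contraNT uA => uD.
  by apply: (subsetP YA); rewrite inE uD.
have bT : burden (losing_sets p T) h v by apply: burdenS b; apply: losing_setsS.
have AT u : u \in A -> u \notin T by move=> uA; rewrite inE uA.
(* If [v] is outside [T], the phase starts in the attractor and the empty invariant suffices. *)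
have [I [Iv HI]] : exists I : seq V -> Prop, (v \in T -> I (v :: h)) /\
   forall r', I r' -> exists w g, [/\ r' = w :: g, w \in T,
      ~ triple (losing_sets p T) r' & force p T (fun u => I (u :: r')) w].
  have [vT|vT] := boolP (v \in T); last by exists (fun=> False).
  exists (safe p T T (losing_sets p T)); split; first by move=> _; apply: sT.
  by move=> r'; apply: safeP.
pose J r := exists a s z, [/\ r = z ++ v :: h, a ++ s = rcons z v,
   all [in T] s, all [in A :&: D] a
   & sorted (fun y w : V => rk y < rk w) a /\ (a = [::] -> I r)].
(* Let [q] form an opponent's set. Its part in [z] lies in [D], and its part in the earlier history
   lies in [D] by the choice of [D]; hence [u] is not in [q]. *)
have exitP z u : all [in D] z -> u \in X -> u \notin D ->
    E (u :: z ++ v :: h).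
  move=> zD uX uD; exists u, (z ++ v :: h); split=> // q t e qK.
  apply: contra uD => uq.
  have [le|lt] := leqP (size q) (size z).
    have [e1 [zE _]] := cat_eq_cat (esym e) le.
    by apply: (allP zD); rewrite zE mem_cat uq.
  have [q' [qE e']] := cat_eq_cat e (ltnW lt).
  have /(Dmax _ _ _ qK e') q'D : all [in Occ q] q'.
    by apply/allP => y yq; rewrite /= inE qE mem_cat yq orbT.
  by move: uq; rewrite qE mem_cat => /orP[/(allP zD)|/(allP q'D)].
exists J; split.
  have [vT|vT] := boolP (v \in T).
    exists [::], [:: v], [::]; rewrite /= vT; split=> //.
    by split=> // _; apply: Iv.
  exists [:: v], [::], [::]; rewrite /= !inE vD !andbT; split=> //.
  by apply: contraR vT; rewrite inE vX andbT.
move=> r [a [s [z [rE asE sT' aAD [a_sorted Ia]]]]].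
have asD : all [in D] (a ++ s).
  rewrite all_cat; apply/andP; split; last first.
    by apply/allP => y /(allP sT')/TD.
  by apply/allP => y /(allP aAD); rewrite inE => /andP[].
have zD : all [in D] z by move: asD; rewrite asE all_rcons => /andP[].
have addP u a' : a' ++ s = rcons z v -> all [in A :&: D] a' ->
    sorted (fun y w : V => rk y < rk w) (u :: a') -> u \in X -> u \in A ->
    J (u :: r) \/ E (u :: r).
  move=> a'E a'AD srt uX uA; have [uD|uD] := boolP (u \in D).
    left; exists (u :: a'), s, (u :: z); split; rewrite //= ?rE ?a'E //.
    by rewrite inE uA uD.
  by right; rewrite rE; apply: exitP.
case: a asE aAD a_sorted Ia asD => [|c a] asE aAD a_sorted Ia asD.
  have [w [g [rE' wT nt fo]]] := HI _ (Ia erefl).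
  have JT u : u \in T -> I (u :: r) -> J (u :: r).
    move=> uT Iu; exists [::], (u :: s), (u :: z).
    by rewrite /= uT sT' -asE; split=> //; rewrite rE.
  exists w, g; split=> //; first exact: (subsetP TX).
    move=> [x3 [x2 [x1 [t [e xK x0 e2 e1]]]]]; apply: nt.
    rewrite rE in e; have [s' [zE _]] := burden_cat b e xK e2 e1.
    move: xK; rewrite inE => /andP[xL _].
    exists x3, x2, x1, t; rewrite rE inE xL; split=> //=.
    apply/subsetP => y; rewrite inE => yx; apply: (allP sT').
    by rewrite -[s]/([::] ++ s) asE mem_rcons inE zE mem_cat yx orbT.
  move: fo; rewrite /force; case: ifPn => _.
    move=> [u [wu uT Iu]]; exists u; split=> //; first exact: (subsetP TX).
    by left; apply: JT.
  move=> fo u wu uX; have [uT|uT] := boolP (u \in T).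
    by left; apply: JT => //; apply: fo.
  by apply: (addP u [::]) => //; move: uT; rewrite inE uX andbT negbK.
have [g rE'] : exists g, r = c :: g.
  by rewrite rE; case: (z) asE => [|c' z'] [-> _]; eexists.
have [cA cD] : c \in A /\ c \in D.
  by move: aAD => /= /andP[]; rewrite inE => /andP[].
exists c, g; split=> //; first exact: (subsetP AX).
  move=> [x3 [x2 [x1 [t [e xK x0 e2 e1]]]]].
  rewrite rE in e; have [s' [zE _]] := burden_cat b e xK e2 e1.
  have cx3 : c \in x3.
    by move: x0 asE; rewrite zE; case: (x3) => // c' x3' _ [-> _];
      apply: mem_head.
  have cx2 : c \in x2 by rewrite e2.
  (* [c] would occur in both [x3] and [x2], so twice in the phase; but it occurs once in the
     attractor part, where ranks are distinct, and never in [T]. *)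
  have := congr1 (count_mem c) asE; rewrite -cats1 zE !count_cat.
  have -> : count_mem c s = 0.
    by apply/count_memPn/negP => /(allP sT'); apply/negP/AT.
  have -> : count_mem c (c :: a) = 1.
    rewrite count_uniq_mem ?mem_head //; apply: sorted_uniq a_sorted => //.
      by move=> x y y'; apply: ltn_trans.
    by move=> x; apply: ltnn.
  move: cx3 cx2; rewrite -!has_pred1 !has_count.
  case: (count_mem c x3) => // m; case: (count_mem c x2) => // m' _ _.
  by rewrite addSn addnS.
apply: force_mono (rkP c cA _) => [u uX [uA ltu]|]; last by rewrite !inE cD.
by apply: (addP u (c :: a)) => //=; rewrite ltu.
Qed.

(* For [X] in [F i], take the largest set [U] solved for the opponent.  If it is
   nonempty, then induction solves the rest [Y] for player [i], as anything the
   opponent wins in [Y] could be added to [U].  If it is empty, then [i] wins all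
   the subgames of [solved_phases] for the same reason. *)
Lemma determinacy X : bipartition F -> subarena X ->
  exists W : player -> {set V},
    (forall p, solved p X (W p)) /\ forall v, v \in X -> exists p, v \in W p.
Proof.
move=> bF; have [n] := ubnP #|X|; elim: n X => // n IH X Xn subX.
have [i Xi] : exists i, X \in F i.
  by case: (bipartition_or Player0 X bF) => ?; eexists; eauto.
suff solX : solved i X X \/ exists W : player -> {set V},
    (forall p, solved p X (W p)) /\ forall v, v \in X -> exists p, v \in W p.
  case: solX => // solX; exists (fun p => if `[< p = i >] then X else set0).
  split=> [p|v vX]; first by case: asboolP => [->|_] //; apply: solved0.
  by exists i; rewrite asboolT.
set p := opponent i.
have [|U /maxsetP[/asboolP solU maxU] _] :=
  @maxset_exists V (fun A => `[< solved p X A >]) set0.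
  exact/asboolP/solved0.
have maxUS S : solved p X (S :|: U) -> [disjoint S & U] -> S = set0.
  move=> /asboolP sS dS; have SU := maxU _ sS (subsetUr _ _).
  apply/eqP; rewrite -subset0 -(setIidPr (subsetUl S U)) SU.
  by rewrite -setI_eq0 setIC in dS; rewrite (eqP dS).
have forceU v : v \in X -> v \notin U -> ~ force p X [in U] v.
  move=> vX vU fo; have /maxUS : solved p X (v |: U) by apply: solved_force.
  by rewrite disjoints1 => /(_ vU)/setP/(_ v); rewrite !inE eqxx.
have sub T : T \subset X :\: U -> T \proper X -> subarena T ->
    (forall v u, v \in T -> v \notin pos G p -> edge G v u -> u \in X ->
      u \in T :|: U) -> solved i T T.
  move=> TU pTX sT trap.
  have [|W [solW covW]] := IH T _ sT.
    by rewrite -ltnS (leq_trans _ Xn) // ltnS proper_card.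
  have TX := proper_sub pTX.
  have WT q : W q \subset T by case: (solW q).
  have dWU : [disjoint W p & U].
    have := subset_trans (WT p) TU; rewrite subsetD => /andP[_ //].
  have Wp0 : W p = set0 by apply: maxUS => //; apply: solved_subgame (solW p).
  suff WiT : W i = T by have := solW i; rewrite WiT.
  apply/eqP; rewrite eqEsubset WT; apply/subsetP => v /covW[q].
  have [->//|->] := player_cases i q.
  by rewrite Wp0 inE.
have posC v : v \in pos G p = (v \notin pos G i).
  exact: bipartition_opponent (pos_bipartition G).
have [U0|/set0Pn[w wU]] := eqVneq U set0.
  left; apply: solved_phases => // D A; rewrite inE.
  move=> /andP[DF DX] YA AX Aclosed.
  (* [A] is closed under forcing by [i], so [X :\: A] is a subarena that [i] cannot leave within
     [X]. *)
  have esc v : v \in X :\: A -> ~ force i X [in A] v.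
    by rewrite inE => /andP[/negP vA vX] /(Aclosed v vX).
  apply: sub; first by rewrite U0 setD0 subsetDl.
  (* As [X] belongs to [F i], the opponent's set [D] misses a vertex of [X], so the subgame is
     smaller. *)
  - apply/properP; split; first exact: subsetDl.
    have /properP[_ [x xX xD]] : D \proper X.
      rewrite properEneq DX andbT; apply: contraTneq DF => ->.
      by rewrite bipartition_opponent // Xi.
    by exists x; rewrite // inE (subsetP YA) // inE xD.
  - move=> v vT; have := esc v vT; rewrite /force.
    have vX : v \in X by move: vT; rewrite inE => /andP[].
    case: ifP => vi nf; last first.
      apply: contrapT => no; apply: nf => u vu uX; apply: contrapT => /negP uA.
      by apply: no; exists u; rewrite // inE uA.
    have [u uX vu] := subX v vX; exists u => //; rewrite inE uX andbT.
    by apply/negP => uA; apply: nf; exists u.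
  - move=> v u vT; rewrite posC negbK U0 setU0 inE => vi vu uX.
    rewrite uX andbT; apply/negP => uA; apply: (esc v vT).
    by rewrite /force vi; exists u.
have UX : U \subset X by case: solU.
(* By maximality of [U] the opponent cannot force a visit to [U] from [Y], so [Y] is a subarena and
   the opponent's vertices in it have no edge into [U]. *)
pose Y := X :\: U.
have YP v : v \in Y -> v \in X /\ ~ force p X [in U] v.
  by rewrite inE => /andP[vU vX]; split=> //; apply: forceU.
have solY : solved i Y Y.
  apply: sub => //.
  - by rewrite properEneq subsetDl andbT; apply/eqP => /setP/(_ w);
      rewrite !inE wU (subsetP UX).
  - move=> v /YP[vX]; rewrite /force; case: ifP => vp nf; last first.
      apply: contrapT => no; apply: nf => u vu uX; apply: contrapT => /negP uU.
      by apply: no; exists u; rewrite // inE uU.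
    have [u uX vu] := subX v vX; exists u => //; rewrite inE uX andbT.
    by apply/negP => uU; apply: nf; exists u.
  - by move=> v u _ _ _ uX; rewrite !inE uX andbT orNb.
right; exists (fun q => if `[< q = i >] then Y else U); split=> [q|v vX].
  case: asboolP => [->|qi]; last by have [|->] := player_cases i q.
  have := @solved_subgame i X set0 Y Y (solved0 _ _); rewrite setU0; apply=> //.
  - exact: subsetDl.
  - by rewrite -setI_eq0 setI0.
  move=> v u /YP[vX nf] vi vu uX; rewrite inE uX andbT.
  by apply/negP => uU; apply: nf; rewrite /force posC vi; exists u.
have [vU|vU] := boolP (v \in U).
  by exists p; case: asboolP => // pi; rewrite /p in pi; case: (i) pi.
by exists i; rewrite asboolT // inE vU.
Qed.

End SafePlay.

(** * Scores along finite and infinite plays *)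

Section Scores.
Variable V : finType.
Implicit Types (A : {set V}) (Fs : {set {set V}}) (w : seq V) (rho : nat -> V).

Lemma score_blocks A w : has_score_blocks A w (score A w).
Proof.
rewrite /score; elim/big_ind: _ => [|k l|k /asboolP//].
  by exists [::]; rewrite /= ?suffix0s.
by rewrite /maxn; case: ifP.
Qed.

Lemma leq_score A w k : has_score_blocks A w k -> k <= score A w.
Proof.
move=> bk; have kw : k < (size w).+1.
  have [xs [<- xsA /suffixP[t ->]]] := bk.
  rewrite ltnS size_cat; apply: leq_trans (leq_addl _ _).
  elim: xs xsA => //= x xs IH xsA; rewrite size_cat -add1n leq_add //.
    by rewrite lt0n size_eq0; have [] := xsA x (mem_head _ _).
  by apply: IH => y yxs; apply: xsA; rewrite inE yxs orbT.
have /asboolP bk' := bk.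
exact: (@leq_bigmax_cond _ _ (fun k : 'I__ => nat_of_ord k) (Ordinal kw)).
Qed.

(* The last block minus its last letter is merged into the previous block. *)
Lemma score_blocks_rcons A w v k :
  has_score_blocks A (rcons w v) k.+2 -> has_score_blocks A w k.+1.
Proof.
move=> [xs [xsk xsA]]; case/lastP: xs xsk xsA => // xs y.
rewrite size_rcons => -[].
case/lastP: xs => // xs x; rewrite size_rcons => -[xsk] xsA.
have [x0 xA] : x != [::] /\ Occ x = A 
  by apply: xsA; rewrite mem_rcons inE mem_rcons mem_head orbT.
have : y != [::] /\ Occ y = A by apply: xsA; rewrite mem_rcons mem_head.
case/lastP: y xsA => [_ []//|y z] xsA [_ yA].
rewrite !flatten_rcons -rcons_cat suffix_rcons => /andP[_ suf].
exists (rcons xs (x ++ y)); split; rewrite ?size_rcons ?xsk //.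
  move=> b; rewrite mem_rcons inE => /orP[/eqP->|bxs]; last first.
    by apply: xsA; rewrite mem_rcons inE mem_rcons inE bxs !orbT.
  split; first by rewrite -size_eq0 size_cat addn_eq0 size_eq0 (negPf x0).
  apply/setP => c; rewrite inE mem_cat -xA inE.
  case: (boolP (c \in x)) => //= cx.
  apply: contraNF cx => cy; have : c \in Occ x.
    by rewrite xA -yA inE mem_rcons inE cy orbT.
  by rewrite inE.
by rewrite flatten_rcons catA.
Qed.

Lemma score_rcons A w v : score A (rcons w v) <= (score A w).+1.
Proof.
have := @score_blocks A (rcons w v); case: (score A _) => [|[|k]] //.
by move/score_blocks_rcons/leq_score.
Qed.

Lemma leq_max_score A Fs w n : A \in Fs -> n < size w ->
  score A (take n.+1 w) <= max_score Fs w.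
Proof.
move=> AF nw; rewrite /max_score (bigD1 A) //= leq_max; apply/orP; left.
by rewrite (bigD1 (Ordinal nw)) //= leq_maxl.
Qed.

Lemma max_score_witness Fs w : 0 < max_score Fs w ->
  exists A n,
    [/\ A \in Fs, n < size w & score A (take n.+1 w) = max_score Fs w].
Proof.
rewrite /max_score => pos.
have [|A AF AE] := @eq_bigmax_cond _ [in Fs]
    (fun A => \max_(n < size w) score A (take n.+1 w)).
  rewrite lt0n; apply: contraTneq pos => F0.
  by rewrite big_pred0 // => A; apply: card0_eq F0 A.
rewrite AE in pos *.
have [|n nE] := @eq_bigmax _ (fun n : 'I_(size w) => score A (take n.+1 w)).
  by rewrite card_ord lt0n; apply: contraTneq pos => ->; rewrite big_ord0.
by exists A, n; rewrite nE.
Qed.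

(** Hence the first prefix whose maximal score exceeds 2 has maximal score exactly 3. *)
Lemma max_score_rcons Fs w v : max_score Fs (rcons w v) <= (max_score Fs w).+1.
Proof.
have [->//|] := posnP (max_score Fs (rcons w v)).
move/max_score_witness => [A [n [AF]]].
rewrite size_rcons ltnS leq_eqVlt => nw <-.
case/orP: nw => [/eqP->|nw]; last first.
  rewrite -cats1 takel_cat //; exact/leqW/leq_max_score.
rewrite take_oversize ?size_rcons //; apply: leq_trans (score_rcons _ _ _) _.
(* [max_score] ranges over non-empty prefixes only, so the empty [w], with score 0, is treated
   apart. *)
rewrite ltnS; case/lastP: w => [|w u].
  by apply: (@leq_trans 0) => //; apply/bigmax_leqP => -[[]].
rewrite -{1}[rcons w u]take_size size_rcons; apply: leq_max_score => //.
by rewrite size_rcons.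
Qed.

Lemma inf_occ_eventually rho :
  exists N, forall n, N <= n -> rho n \in inf_occ rho.
Proof.
have H v : exists N, v \notin inf_occ rho -> forall n, N <= n -> rho n <> v.
  have [vi|] := boolP (v \in inf_occ rho); first by exists 0.
  rewrite inE => /asboolPn nv; have /existsNP[N HN] := nv.
  by exists N => _ n Nn e; apply: HN; exists n.
have [f Hf] := choice H.
exists (\max_v f v) => n le; apply: contraT => /Hf /(_ n) [] //.
exact: leq_trans (leq_bigmax _) le.
Qed.

Lemma inf_occ_block rho N : exists2 n, N < n &
  {subset inf_occ rho <= [seq rho i | i <- index_iota N n]}.
Proof.
have H v : exists n, v \in inf_occ rho -> N <= n /\ rho n = v.
  have [|_] := boolP (v \in inf_occ rho); last by exists 0.
  by rewrite inE => /asboolP/(_ N)[n Nn e]; exists n.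
have [f Hf] := choice H.
exists (maxn N (\max_v f v)).+1 => [|v /Hf[Nf <-]].
  by rewrite ltnS leq_maxl.
apply: map_f; rewrite mem_index_iota Nf ltnS leq_max.
by apply/orP; right; apply: leq_bigmax.
Qed.

(** Once only vertices of [inf_occ rho] occur, the play splits into consecutive segments each of
    which visits all of them. *)
Lemma inf_occ_score rho k :
  exists n, has_score_blocks (inf_occ rho) (mkseq rho n) k.
Proof.
have [N HN] := inf_occ_eventually rho.
suff [n [Nn [xs [xsk xsA fl]]]] : exists n, N <= n /\ exists xs,
    [/\ size xs = k,
    forall x, x \in xs -> x != [::] /\ Occ x = inf_occ rho
    & flatten xs = [seq rho i | i <- index_iota N n]].
  exists n, xs; split=> //; rewrite fl /mkseq; apply/suffixP.
  exists [seq rho i | i <- iota 0 N]; rewrite -map_cat; congr map.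
  by rewrite -{1}(subnKC Nn) iotaD.
elim: k => [|k [n [Nn [xs [xsk xsA fl]]]]].
  by exists N; split=> //; exists [::]; rewrite /index_iota subnn.
have [m nm sub] := inf_occ_block rho n.
exists m; split; first exact: leq_trans (ltnW nm).
exists (rcons xs [seq rho i | i <- index_iota n m]); split.
- by rewrite size_rcons xsk.
- move=> x; rewrite mem_rcons inE => /orP[/eqP->|]; last exact: xsA.
  split; first by rewrite -size_eq0 size_map size_iota subn_eq0 -ltnNge.
  apply/setP => v; rewrite inE; apply/idP/idP => [/mapP[i]|]; last exact: sub.
  by rewrite mem_index_iota => /andP[ni _] ->; apply/HN/(leq_trans Nn).
- rewrite flatten_rcons fl -map_cat /index_iota; congr map.
  by rewrite -{2}(subnKC Nn) -iotaD; congr iota; lia.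
Qed.

End Scores.

(** * From safe plays to winning regions *)

Section Regions.
Variables (V : finType) (G : arena V) (F : player -> {set {set V}}).
Implicit Types (p : player) (v : V) (rho : nat -> V).

Lemma blocks_triple (K : {set {set V}}) A w : A \in K ->
  has_score_blocks A w 3 -> triple K (rev w).
Proof.
move=> AK [[|x1 [|x2 [|x3 [|x4 xs]]]] []] // _ xsA /suffixP[t ->].
have [_ o1] : x1 != [::] /\ Occ x1 = A by apply: xsA; rewrite !inE eqxx.
have [_ o2] : x2 != [::] /\ Occ x2 = A by apply: xsA; rewrite !inE eqxx orbT.
have [n3 o3] : x3 != [::] /\ Occ x3 = A by apply: xsA; rewrite !inE eqxx !orbT.
exists (rev x3), (rev x2), (rev x1), (rev t).
have oE (y z : seq V) : Occ y = Occ z -> y =i z.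
  by move=> e c; have := congr1 (fun B : {set V} => c \in B) e; rewrite !inE.
split.
- by rewrite /= cats0 !rev_cat -!catA.
- suff -> : Occ (rev x3) = A by [].
  by rewrite -o3; apply/setP => c; rewrite !inE mem_rev.
- by rewrite -size_eq0 size_rev size_eq0.
- by move=> c; rewrite !mem_rev; apply: oE; rewrite o2 o3.
- by move=> c; rewrite !mem_rev; apply: oE; rewrite o1 o3.
Qed.

Lemma safe_strategy p A K v : safe G p setT A K [:: v] ->
  exists sigma, [/\ is_strategy G p sigma,
    forall rho, is_play G v rho -> consistent G p sigma rho ->
      forall m, ~ triple K (rev (mkseq rho m.+1))
  & forall q, path (edge G) v q -> finite_consistent G p sigma v q ->
      forall m, m < size (v :: q) -> ~ triple K (rev (take m.+1 (v :: q)))].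
Proof.
move=> [I [Iv HI]].
(* The strategy picks a successor that preserves the invariant; elsewhere any successor [u0] serves
   as a default. *)
have /choice[f Hf] (ws : seq V * V) : exists u, edge G ws.2 u /\
    (I (rev (rcons ws.1 ws.2)) -> ws.2 \in pos G p ->
     I (u :: rev (rcons ws.1 ws.2))).
  case: ws => w s /=; have [u0 su0] := edge_total G s.
  have [Iw|nI] := pselect (I (rev (rcons w s))); last by exists u0.
  have [sp|nsp] := boolP (s \in pos G p); last by exists u0.
  have [c [g [rE _ _]]] := HI _ Iw.
  rewrite rev_rcons in rE; case: rE => <- _.
  by rewrite /force sp => -[u [su _ [Iu|//]]]; exists u.
exists (fun w s => f (w, s)).
have step w s u : I (rev (rcons w s)) -> edge G s u ->
    (s \in pos G p -> u = f (w, s)) -> I (rev (rcons (rcons w s) u)).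
  move=> Iw su uE; rewrite rev_rcons; have [sp|sp] := boolP (s \in pos G p).
    by rewrite uE //; apply: (Hf (w, s)).2.
  have [c [g [rE _ _]]] := HI _ Iw.
  have cE : c = s by rewrite rev_rcons in rE; case: rE.
  by rewrite /force cE (negPf sp) => /(_ u su (in_setT _))[].
have nt r : I r -> ~ triple K r by case/HI => ? [? []].
split=> [w s _|rho [rho0 rhoE] cons m|q pq cons m mq].
- exact: (Hf (w, s)).1.
- apply: nt; elim: m => [|m IH]; first by rewrite /mkseq /= rho0.
  by rewrite -addn1 mkseqS addn1 mkseqS in IH *; apply: step => //; apply: cons.
- apply: nt; elim: m mq => [|m IH] mq; first by rewrite /= take0.
  have := IH (ltnW mq); rewrite (take_nth v mq) (take_nth v (ltnW mq)).
  move=> Im; apply: step => //; first exact: (pathP v pq).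
  exact: cons.
Qed.

Lemma losing_setsT p : losing_sets F p setT = F (opponent p).
Proof. by apply/setP => A; rewrite inE subsetT andbT. Qed.

Lemma solved_muller p A v : bipartition F -> solved G F p setT A -> v \in A ->
  v \in muller_region G F p.
Proof.
move=> bF [_ sA] vA; have := sA v [::] vA (@burden_nil _ _ _).
rewrite losing_setsT => /safe_strategy[sigma [st nt _]].
rewrite inE; apply/asboolP; exists sigma; split=> // rho pl co.
have [//|lo] := bipartition_or p (inf_occ rho) bF.
(* An opponent's set visited infinitely often would reach score 3; the empty prefix has no room for
   three blocks. *)
have [[|n] Hn] := inf_occ_score rho 3; last first.
  by case: (nt rho pl co n); apply: blocks_triple lo Hn.
by have := leq_score Hn; rewrite leqNgt => /negP[]; rewrite ltnS;
  apply/bigmax_leqP => -[[|[]]].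
Qed.

Lemma solved_finite p A v : bipartition F -> solved G F p setT A -> v \in A ->
  v \in finite_time_region G F 3 p.
Proof.
move=> bF [_ sA] vA; have := sA v [::] vA (@burden_nil _ _ _).
rewrite losing_setsT => /safe_strategy[sigma [st _ nt]].
rewrite inE; apply/asboolP; exists sigma; split=> // q [pq q3 q2] co.
have {}nt B : score B (v :: q) = 3 -> B \notin F (opponent p).
  move=> B3; apply/negP => lo; case: (nt q pq co (size q) (ltnSn _)).
  by rewrite -/(size (v :: q)) take_size; apply: blocks_triple lo _;
    rewrite -B3; apply: score_blocks.
(* Player 1 wins by the absence of a set of Player 0 with score 3, whereas Player 0 must exhibit a
   set; it is the one that reaches score 3 at the last vertex. *)
case: p nt {co st sA vA A} => /= nt; last by case=> B /nt/negP.
have [|B [n [_ nq]]] := @max_score_witness _ setT (v :: q); first by rewrite q3.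
rewrite q3 lastI => B3; have nE : n = size q.
  apply/eqP; rewrite eqn_leq -ltnS nq leqNgt; apply: contraTN q2 => nq'.
  rewrite -leqNgt -B3 -cats1 takel_cat ?size_belast //.
  by apply: leq_max_score; rewrite ?inE ?size_belast.
move: B3; rewrite nE -lastI -/(size (v :: q)) take_size => B3.
exists B => //; have [//|lo] := bipartition_or Player0 B bF.
by have := nt B B3; rewrite lo.
Qed.

Lemma playout (s : player -> strategy V) v :
  (forall p, is_strategy G p (s p)) ->
  exists2 rho, is_play G v rho & forall p, consistent G p (s p) rho.
Proof.
move=> st.
pose next (c : seq V * V) := (rcons c.1 c.2,
  (if c.2 \in pos G Player0 then s Player0 else s Player1) c.1 c.2).
pose rho n := (iter n next ([::], v)).2.
have hist n : (iter n next ([::], v)).1 = mkseq rho n.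
  by elim: n => //= n ->; rewrite mkseqS.
have rhoS n : rho n.+1 =
    (if rho n \in pos G Player0 then s Player0 else s Player1)
      (mkseq rho n) (rho n).
  by rewrite -hist.
have posC u : u \in pos G Player1 = (u \notin pos G Player0).
  exact: (@bipartition_opponent _ _ Player0 u (pos_bipartition G)).
exists rho; first split=> // m.
  by rewrite rhoS; case: ifPn => um; apply: st => //; rewrite posC.
by case=> m; rewrite ?posC rhoS; [move=> ->|move=> /negPf->].
Qed.

Lemma muller_disjoint v : bipartition F ->
  (forall p, v \in muller_region G F p) -> False.
Proof.
move=> bF vR; have /choice[s Hs] p : exists sigma, is_strategy G p sigma /\
      forall rho, is_play G v rho -> consistent G p sigma rho ->
        muller_wins F p rho.
  by have := vR p; rewrite inE => /asboolP.
have [rho pl co] := playout v (fun p => (Hs p).1).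
apply: (@bipartition_disj _ _ Player0 _ bF ((Hs Player0).2 rho pl (co _))).
exact: (Hs Player1).2.
Qed.

(** When both players follow winning strategies, the shortest prefix of the resulting play with
    maximal score above 2 is a finite play won by both. *)
Lemma finite_time_disjoint v :
  (forall p, v \in finite_time_region G F 3 p) -> False.
Proof.
move=> vR; have /choice[s Hs] p : exists sigma, is_strategy G p sigma /\
      forall q, is_finite_play G 3 v q -> finite_consistent G p sigma v q ->
        finite_wins F 3 p (v :: q).
  by have := vR p; rewrite inE => /asboolP.
have [rho [rho0 rhoE] co] := playout v (fun p => (Hs p).1).
have : exists n, 2 < max_score setT (mkseq rho n).
  have [[|n] Hn] := inf_occ_score rho 3.
    have := leq_score Hn; rewrite leqNgt => /negP[]; rewrite ltnS.
    by apply/bigmax_leqP => -[[|[]]].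
  exists n.+1; apply: leq_trans (leq_score Hn) _.
  rewrite -{1}(take_size (mkseq rho n.+1)) size_mkseq.
  by apply: leq_max_score; rewrite ?inE ?size_mkseq.
case/ex_minnP=> -[|n] n3 nmin.
  have [A [m [_]]] := max_score_witness (ltn_trans (isT : 0 < 2) n3).
  by [].
pose q := [seq rho i | i <- iota 1 n].
have qE : v :: q = mkseq rho n.+1 by rewrite -rho0.
have sq : size q = n by rewrite size_map size_iota.
have qn : max_score setT (mkseq rho n) < 3.
  by rewrite ltnNge; apply/negP => /nmin; rewrite ltnn.
have nthE m : m <= n -> nth v (v :: q) m = rho m.
  by move=> mn; rewrite qE nth_mkseq.
have fp : is_finite_play G 3 v q.
  split.
  - apply/(pathP v) => m; rewrite sq => mn.
    by rewrite (nthE m (ltnW mn)) (nthE m.+1 mn : nth v q m = _).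
  - rewrite qE; apply/eqP; rewrite eqn_leq n3 andbT mkseqS.
    exact: leq_trans (max_score_rcons _ _ _) _.
  - suff -> : belast v q = mkseq rho n by [].
    by have := lastI v q; rewrite qE mkseqS => /rcons_inj[].
have fc p : finite_consistent G p (s p) v q.
  rewrite /finite_consistent => m; rewrite [size _]/= sq ltnS => mn.
  rewrite (nthE m (ltnW mn)) => mp.
  rewrite (nthE m.+1 mn) (co p m mp); congr s.
  by rewrite qE /mkseq -map_take take_iota (minn_idPl (leqW (ltnW mn))).
exact: (Hs Player1).2 q fp (fc _) ((Hs Player0).2 q fp (fc _)).
Qed.

End Regions.

Theorem theorem14 (V : finType) (G : arena V) (F : player -> {set {set V}})
    (hF : bipartition F) (i : player) :
  muller_region G F i = finite_time_region G F 3 i.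
Proof.
have [|W [solW covW]] := @determinacy V G F setT hF.
  by move=> v _; have [u vu] := edge_total G v; exists u.
have regE (R : player -> {set V}) : (forall p, W p \subset R p) ->
    (forall v, ~ forall p, v \in R p) -> R i = W i.
  move=> WR RD; apply/eqP; rewrite eqEsubset WR andbT; apply/subsetP => v vi.
  have [p vp] := covW v (in_setT v); have [<-//|pE] := player_cases i p.
  case: (RD v) => q; have [->//|->] := player_cases i q.
  by rewrite -pE; apply: (subsetP (WR p)).
rewrite (regE (finite_time_region G F 3)); first apply: regE.
- by move=> p; apply/subsetP => v; apply: solved_muller (solW p).
- by move=> v; apply: muller_disjoint.
- by move=> p; apply/subsetP => v; apply: solved_finite (solW p).
- by move=> v; apply: finite_time_disjoint.
Qed.
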